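(* Let $K$ be a field and let $A=\bigoplus_{n\in\mathbb N}A_n$, $A_0=K$, be a graded connected quasi-shuffle bialgebra over $K$, with augmentation ideal $A_+=\bigoplus_{n\ge1}A_n$. For $n\ge1$ let $p_n:A_+\to A_+$ be the projection onto $A_n$ (the homogeneous components of the identity), let $\pi:A_+\to A_+$ be the unique linear map with $\mathrm{Id}=\pi+\pi\prec\mathrm{Id}$ (a projection onto $Prim(A)$), and let $q_n=p_n\circ\pi$ ($n\ge1$) be its homogeneous components. Then the NQSh subalgebra of $\mathrm{End}_K(A_+)$ generated by the $p_n$, $n\ge1$, is also generated by the $q_n$, $n\ge1$. Moreover, for all $n\ge1$, $$q_n=\sum_{m=1}^n(-1)^{m+1}\sum_{\substack{a_1+\cdots+a_m=n\\ a_i\ge1}}p_{a_1}\prec(p_{a_2}\star\cdots\star p_{a_m}),$$ the term for $m=1$ being $p_n$.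
   Context: A quasi-shuffle algebra is a nonunital commutative associative algebra $(B,\bullet)$ with another bilinear product $\prec$ such that $(x\prec y)\prec z=x\prec(y\star z)$ and $(x\bullet y)\prec z=x\bullet(y\prec z)$, where $x\star y:=x\prec y+y\prec x+x\bullet y$; set $x\succ y:=y\prec x$. A quasi-shuffle bialgebra is $K\oplus B$, with $B$ a quasi-shuffle algebra and $1$ a unit for $\star$, equipped with a coassociative counital coproduct $\Delta$, $\Delta(1)=1\otimes1$, such that, writing $\tilde\Delta(b)=\Delta(b)-b\otimes1-1\otimes b=:b'\otimes b''\in B\otimes B$, for all $x,y\in B$: $\tilde\Delta(x\prec y)=x'\prec y'\otimes x''\star y''+x'\otimes x''\star y+x\prec y'\otimes y''+x'\prec y\otimes x''+x\otimes y$ and $\tilde\Delta(x\bullet y)=x'\bullet y'\otimes x''\star y''+x'\bullet y\otimes x''+x\bullet y'\otimes y''$. Graded: $\prec,\bullet,\Delta$ are homogeneous of degree $0$ (here $B=A_+$). $Prim(A)=\ker\tilde\Delta$. NQSh algebra: a nonunital associative algebra $(C,\bullet)$ with two further bilinear products $\prec,\succ$ such that, with $\star:=\prec+\succ+\bullet$: $(x\prec y)\prec z=x\prec(y\star z)$; $(x\succ y)\prec z=x\succ(y\prec z)$; $(x\star y)\succ z=x\succ(y\succ z)$; $(x\prec y)\bullet z=x\bullet(y\succ z)$; $(x\succ y)\bullet z=x\succ(y\bullet z)$; $(x\bullet y)\prec z=x\bullet(y\prec z)$. $\mathrm{End}_K(A_+)$ is an NQSh algebra with $f\diamond g:=\diamond\circ(f\otimes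 g)\circ\tilde\Delta$ for $\diamond\in\{\prec,\succ,\bullet\}$ (and then $\star$ is the convolution product associated with $\tilde\Delta$). An NQSh subalgebra is a subspace stable under $\prec,\succ,\bullet$. *)

(* Defs.v *)
From HB Require Import structures.
From mathcomp Require Import all_boot all_order all_algebra.
From mathcomp Require Import boolp classical_sets functions.

Set Implicit Arguments.
Unset Strict Implicit.
Unset Printing Implicit Defensive.

Import GRing.Theory.

Local Open Scope ring_scope.
Local Open Scope classical_set_scope.
Local Open Scope quotient_scope.

(* Tensor product of arbitrary (possibly infinite-dimensional) vector spaces. *)
(* A tensor is a class of formal sums [:: (u1, v1); ...; (ur, vr)], two sums  *)
(* being identified when no bilinear map separates them. Universal            *)
(* property: tens_bilinear, tlift_tens, tlift_linear and tlift_unique.         *)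
Section Tensor.
Variables (K : fieldType) (U V : lmodType K).

Definition tens_rel : rel (seq (U * V)) := fun s t =>
  `[< forall (W : lmodType K) (F : {bilinear U -> V -> W}),
        \sum_(z <- s) F z.1 z.2 = \sum_(z <- t) F z.1 z.2 >].

Lemma tens_rel_refl : reflexive tens_rel.
Proof. by move=> s; apply/asboolP. Qed.

Lemma tens_rel_sym : symmetric tens_rel.
Proof. by move=> s t; apply/asboolP/asboolP => h W F; rewrite h. Qed.

Lemma tens_rel_trans : transitive tens_rel.
Proof.
by move=> t s r /asboolP st /asboolP tr; apply/asboolP => W F; rewrite st tr.
Qed.

Canonical tens_equiv :=
  EquivRel tens_rel tens_rel_refl tens_rel_sym tens_rel_trans.

Definition tensor := {eq_quot tens_equiv}.
HB.instance Definition _ := Choice.on tensor.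
HB.instance Definition _ := EqQuotient.on tensor.

(* If F is bilinear, the linear map induced by F; tlift F t is the Sweedler   *)
(* expression F t' t'' for t = t' (x) t''. Junk when F is not bilinear.       *)
Definition tlift (W : nmodType) (F : U -> V -> W) (t : tensor) : W :=
  \sum_(z <- repr t) F z.1 z.2.

Definition tens (u : U) (v : V) : tensor := \pi_tensor [:: (u, v)].

Definition tens_zero : tensor := \pi_tensor [::].
Definition tens_add (s t : tensor) : tensor := \pi_tensor (repr s ++ repr t).
Definition tens_scale (a : K) (t : tensor) : tensor :=
  \pi_tensor [seq (a *: z.1, z.2) | z <- repr t].

Lemma tlift_pi (W : lmodType K) (F : {bilinear U -> V -> W}) s :
  tlift F (\pi_tensor s) = \sum_(z <- s) F z.1 z.2.
Proof.
rewrite /tlift; have : repr (\pi_tensor s) = s %[mod tensor] by rewrite reprK.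
by move/eqmodP/asboolP; apply.
Qed.

Lemma tensP (s t : tensor) :
  (forall (W : lmodType K) (F : {bilinear U -> V -> W}),
    tlift F s = tlift F t) -> s = t.
Proof.
move=> h; rewrite -[s]reprK -[t]reprK.
by apply/eqmodP/asboolP => W F; exact: h.
Qed.

Lemma tlift_zero (W : lmodType K) (F : {bilinear U -> V -> W}) :
  tlift F tens_zero = 0.
Proof. by rewrite tlift_pi big_nil. Qed.

Lemma tlift_add (W : lmodType K) (F : {bilinear U -> V -> W}) s t :
  tlift F (tens_add s t) = tlift F s + tlift F t.
Proof. by rewrite tlift_pi big_cat. Qed.

Lemma tlift_scale (W : lmodType K) (F : {bilinear U -> V -> W}) a t :
  tlift F (tens_scale a t) = a *: tlift F t.
Proof.
rewrite tlift_pi big_map /tlift scaler_sumr.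
by apply: eq_bigr => z _ /=; rewrite linearZl_LR.
Qed.

Definition tliftE := (tlift_zero, tlift_add, tlift_scale).

Lemma tens_addA : associative tens_add.
Proof. by move=> r s t; apply: tensP => W F; rewrite !tliftE addrA. Qed.
Lemma tens_addC : commutative tens_add.
Proof. by move=> s t; apply: tensP => W F; rewrite !tliftE addrC. Qed.
Lemma tens_add0 : left_id tens_zero tens_add.
Proof. by move=> s; apply: tensP => W F; rewrite !tliftE add0r. Qed.
Lemma tens_addN : left_inverse tens_zero (tens_scale (-1)) tens_add.
Proof.
by move=> s; apply: tensP => W F; rewrite !tliftE scaleN1r addNr.
Qed.

HB.instance Definition _ :=
  GRing.isZmodule.Build tensor tens_addA tens_addC tens_add0 tens_addN.

Lemma tens_scaleA a b t : tens_scale a (tens_scale b t) = tens_scale (a * b) t.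
Proof. by apply: tensP => W F; rewrite !tliftE scalerA. Qed.
Lemma tens_scale1 : left_id 1 tens_scale.
Proof. by move=> s; apply: tensP => W F; rewrite !tliftE scale1r. Qed.
Lemma tens_scaleDr : right_distributive tens_scale +%R.
Proof. by move=> a s t; apply: tensP => W F; rewrite !tliftE scalerDr. Qed.
Lemma tens_scaleDl t : {morph tens_scale^~ t : a b / a + b >-> a + b}.
Proof. by move=> a b; apply: tensP => W F; rewrite !tliftE scalerDl. Qed.

HB.instance Definition _ := GRing.Zmodule_isLmodule.Build K tensor
  tens_scaleA tens_scale1 tens_scaleDr tens_scaleDl.

Lemma tlift_tens (W : lmodType K) (F : {bilinear U -> V -> W}) u v :
  tlift F (tens u v) = F u v.
Proof. by rewrite tlift_pi big_seq1. Qed.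

Lemma tens_bilinear : bilinear_for *:%R *:%R tens.
Proof.
split=> [v a u u'|u a v v']; apply: tensP => W F.
  by rewrite tlift_add tlift_scale !tlift_tens linearPl.
by rewrite tlift_add tlift_scale !tlift_tens linearPr.
Qed.

HB.instance Definition _ :=
  bilinear_isBilinear.Build K U V tensor *:%R *:%R tens tens_bilinear.

Lemma tlift_linear (W : lmodType K) (F : {bilinear U -> V -> W}) :
  linear (tlift F).
Proof. by move=> a s t; rewrite tlift_add tlift_scale. Qed.

Lemma tensor_sum (t : tensor) : t = \sum_(z <- repr t) tens z.1 z.2.
Proof.
apply: tensP => W F.
pose G : {linear tensor -> W} :=
  HB.pack (tlift F) (GRing.isLinear.Build K tensor W *:%R (tlift F)
    (tlift_linear F)).
rewrite -[RHS]/(G _) linear_sum /=.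
by apply: eq_bigr => z _; rewrite tlift_tens.
Qed.

Lemma tlift_unique (W : lmodType K) (h : {linear tensor -> W}) t :
  h t = tlift (fun u v => h (tens u v)) t.
Proof. by rewrite {1}[t]tensor_sum linear_sum. Qed.

End Tensor.

Arguments tens {K U V} u v.
Arguments tlift {K U V W} F t.

Notation "u *t v" := (tens u v) (at level 40, left associativity).

Section TensorMaps.
Variables (K : fieldType).

Definition tmap (U V U' V' : lmodType K) (f : U -> U') (g : V -> V')
    (t : tensor U V) : tensor U' V' :=
  tlift (fun u v => f u *t g v) t.

Definition tassoc (U V W : lmodType K) (t : tensor (tensor U V) W) :
    tensor U (tensor V W) :=
  tlift (fun s w => tlift (fun u v => u *t (v *t w)) s) t.

End TensorMaps.

(* K (+) B *)
Definition aug (K : fieldType) (B : lmodType K) : lmodType K := (K^o * B)%type.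

Section QuasiShuffle.
Variables (K : fieldType) (B : lmodType K).
Variables prec bul : {bilinear B -> B -> B}.

Definition star (x y : B) : B := prec x y + prec y x + bul x y.
Definition succ (x y : B) : B := prec y x.

Record quasi_shuffle_algebra : Prop := {
  qs_bulA : associative bul;
  qs_bulC : commutative bul;
  qs_precA : forall x y z, prec (prec x y) z = prec x (star y z);
  qs_bul_prec : forall x y z, prec (bul x y) z = bul x (prec y z) }.

Definition unitA : aug B := (1, 0).
Definition inB (b : B) : aug B := (0, b).
Definition epsA (a : aug B) : K := a.1.
Definition prB (a : aug B) : B := a.2.

Variable Delta : {linear aug B -> tensor (aug B) (aug B)}.

Definition Delta_rem (b : B) : tensor (aug B) (aug B) :=
  Delta (inB b) - inB b *t unitA - unitA *t inB b.

(* The element of B (x) B whose image in A (x) A is Delta_rem b, see          *)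
(* qsb_reduced below.                                                         *)
Definition rDelta (b : B) : tensor B B := tmap prB prB (Delta_rem b).

Record quasi_shuffle_bialgebra : Prop := {
  qsb_algebra : quasi_shuffle_algebra;
  qsb_coassoc : forall a,
    tassoc (tmap Delta id (Delta a)) = tmap id Delta (Delta a);
  qsb_counitl : forall a, tlift (fun u v => epsA u *: v) (Delta a) = a;
  qsb_counitr : forall a, tlift (fun u v => epsA v *: u) (Delta a) = a;
  qsb_unit : Delta unitA = unitA *t unitA;
  qsb_reduced : forall b, tmap inB inB (rDelta b) = Delta_rem b;
  qsb_prec : forall x y, rDelta (prec x y) =
      tlift (fun x' x'' => tlift (fun y' y'' =>
        prec x' y' *t star x'' y'') (rDelta y)) (rDelta x)
    + tlift (fun x' x'' => x' *t star x'' y) (rDelta x)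
    + tlift (fun y' y'' => prec x y' *t y'') (rDelta y)
    + tlift (fun x' x'' => prec x' y *t x'') (rDelta x)
    + x *t y;
  qsb_bul : forall x y, rDelta (bul x y) =
      tlift (fun x' x'' => tlift (fun y' y'' =>
        bul x' y' *t star x'' y'') (rDelta y)) (rDelta x)
    + tlift (fun x' x'' => bul x' y *t x'') (rDelta x)
    + tlift (fun y' y'' => bul x y' *t y'') (rDelta y) }.

Definition Prim : set B := [set b | rDelta b = 0].

Definition is_subspace (V : lmodType K) (S : set V) : Prop :=
  S 0 /\ forall (a : K) u v, S u -> S v -> S (a *: u + v).

(* V is the (internal) direct sum of the gr n, n >= 0 *)
Record is_grading (V : lmodType K) (gr : nat -> set V) : Prop := {
  gr_subspace : forall n, is_subspace (gr n);
  gr_span : forall v, exists (N : nat) (c : nat -> V),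
    (forall n, gr n (c n)) /\ v = \sum_(n < N) c n;
  gr_direct : forall (N : nat) (c : nat -> V), (forall n, gr n (c n)) ->
    \sum_(n < N) c n = 0 -> forall n, (n < N)%N -> c n = 0 }.

(* the degree n part of V (x) V, i.e. the sum of the gr i (x) gr j, i + j = n *)
Definition tensor_gr (V : lmodType K) (gr : nat -> set V) (n : nat) :
    set (tensor V V) :=
  [set t | exists s : seq (V * V), t = \sum_(z <- s) z.1 *t z.2 /\
    forall z, z \in s -> exists i j, [/\ (i + j)%N = n, gr i z.1 & gr j z.2]].

Variable gr : nat -> set (aug B).

Record graded_connected_qsb : Prop := {
  gqs_bialgebra : quasi_shuffle_bialgebra;
  gqs_grading : is_grading gr;
  gqs_connected : gr 0%N = [set a | prB a = 0];
  gqs_augmentation : forall n a, (0 < n)%N -> gr n a -> epsA a = 0;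
  gqs_prec : forall i j x y, gr i (inB x) -> gr j (inB y) ->
    gr (i + j)%N (inB (prec x y));
  gqs_bul : forall i j x y, gr i (inB x) -> gr j (inB y) ->
    gr (i + j)%N (inB (bul x y));
  gqs_Delta : forall n a, gr n a -> tensor_gr gr n (Delta a) }.

(* f is the projection of A_+ = B onto its component of degree n, n >= 1 *)
Definition is_proj_component (n : nat) (f : B -> B) : Prop :=
  linear f /\ forall m x, (0 < m)%N -> gr m (inB x) ->
    f x = if m == n then x else 0.

Definition conv (op : B -> B -> B) (f g : B -> B) : B -> B :=
  fun b => tlift op (tmap f g (rDelta b)).

Definition eprec : (B -> B) -> (B -> B) -> (B -> B) := conv prec.
Definition esucc : (B -> B) -> (B -> B) -> (B -> B) := conv succ.
Definition ebul : (B -> B) -> (B -> B) -> (B -> B) := conv bul.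
Definition estar (f g : B -> B) : B -> B := eprec f g + esucc f g + ebul f g.

(* End_K(B) is realized as the space of linear functions in B -> B *)
Record nqsh_subalgebra (S : set (B -> B)) : Prop := {
  nqsh_linear : forall f, S f -> linear f;
  nqsh_subspace : is_subspace S;
  nqsh_prec : forall f g, S f -> S g -> S (eprec f g);
  nqsh_succ : forall f g, S f -> S g -> S (esucc f g);
  nqsh_bul : forall f g, S f -> S g -> S (ebul f g) }.

Definition nqsh_generated (G : set (B -> B)) : set (B -> B) :=
  smallest nqsh_subalgebra G.

Definition is_pi (f : B -> B) : Prop := linear f /\ id = f + eprec f id.

Definition is_projection_onto (f : B -> B) (S : set B) : Prop :=
  (forall x, f (f x) = f x) /\ range f = S.

(* f1 < (f2 * ... * fm) for the sequence f1, ..., fm, and f1 when m = 1 *)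
Definition prec_star (fs : seq (B -> B)) : B -> B :=
  match fs with
  | [::] => 0
  | [:: f] => f
  | f :: g :: hs => eprec f (foldl estar g hs)
  end.

End QuasiShuffle.

(* Main.v *)
(* Since [p n (x < y)] is the sum of the [p a x < p (n - a) y], taking the
   degree n part of [Id = pi + pi < Id] gives
     [p n = q n + sum_(0 < a < n) q a < p (n - a)].
   This triangular relation expresses each family through the other, which
   gives the equality of the generated subalgebras; unrolling it with
   [(f < g) < h = f < (g * h)] in End(B) gives the explicit formula.
   The reduced coproduct lowers degrees, so [pi b = b - pi b_1 < b_2] determines
   [pi] by recursion on the degree; and if [pi b_1] is primitive, then
     [rDelta (pi b_1 < b_2) = (pi b_1 < b_2) (x) b_3 + pi b_1 (x) b_2],
   which by coassociativity is [b_1 (x) b_2 = rDelta b]. *)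

Require Import Defs.
From HB Require Import structures.
From mathcomp Require Import all_boot all_order all_algebra.
From mathcomp Require Import boolp classical_sets functions.

Set Implicit Arguments.
Unset Strict Implicit.
Unset Printing Implicit Defensive.

Import GRing.Theory.

Local Open Scope ring_scope.
Local Open Scope classical_set_scope.

(** * Sweedler calculus: multilinear maps and tensors *)

Section Sweedler.
Variable K : fieldType.
Implicit Types U V W : lmodType K.

(* Convertible to [linear f], whose scaling operation is hidden behind a
   structure projection that rewriting does not see through. *)
Definition is_lin U V (f : U -> V) := forall a x y, f (a *: x + y) = a *: f x + f y.

Definition bilin U V W (F : U -> V -> W) :=
  (forall v, is_lin (F^~ v)) /\ (forall u, is_lin (F u)).

Lemma linear_is0 U V (f : U -> V) : is_lin f -> f 0 = 0.
Proof. by move=> lf; have := lf (-1) 0 0; rewrite scaler0 addr0 scaleN1r addNr. Qed.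

Lemma linear_isD U V (f : U -> V) : is_lin f -> {morph f : x y / x + y}.
Proof. by move=> lf x y; have := lf 1 x y; rewrite !scale1r. Qed.

Lemma linear_isB U V (f : U -> V) : is_lin f -> {morph f : x y / x - y}.
Proof. by move=> lf x y; have := lf (-1) y x; rewrite !scaleN1r !(addrC (- _)). Qed.

Lemma linear_is_sum U V (f : U -> V) I (r : seq I) (P : pred I) (E : I -> U) :
  is_lin f -> f (\sum_(i <- r | P i) E i) = \sum_(i <- r | P i) f (E i).
Proof. by move=> lf; exact: (big_morph f (linear_isD lf) (linear_is0 lf)). Qed.

Lemma tlift_is_linear U V W (F : U -> V -> W) : bilin F -> is_lin (tlift F).
Proof.
move=> bF.
pose G : {bilinear U -> V -> W} :=
  HB.pack F (bilinear_isBilinear.Build K U V W *:%R *:%R F bF).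
exact: (tlift_linear G).
Qed.

Lemma tlift_is_tens U V W (F : U -> V -> W) u v :
  bilin F -> tlift F (u *t v) = F u v.
Proof.
move=> bF.
pose G : {bilinear U -> V -> W} :=
  HB.pack F (bilinear_isBilinear.Build K U V W *:%R *:%R F bF).
exact: (tlift_tens G).
Qed.

(** Allows evaluation on any expansion into pure tensors, in particular a homogeneous one, instead
    of the arbitrary representative [repr t]. *)
Lemma tlift_sum_tens U V W (F : U -> V -> W) I (s : seq I) (f : I -> U) (g : I -> V) :
  bilin F ->
  tlift F (\sum_(z <- s) f z *t g z) = \sum_(z <- s) F (f z) (g z).
Proof.
move=> bF; rewrite linear_is_sum; last exact: tlift_is_linear.
by apply: eq_bigr => z _; rewrite tlift_is_tens.
Qed.

Lemma tlift_tmap U V U' V' W (F : U' -> V' -> W) (f : U -> U') (g : V -> V') t :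
  bilin F -> tlift F (tmap f g t) = tlift (fun u v => F (f u) (g v)) t.
Proof. exact: tlift_sum_tens. Qed.

Lemma linear_tlift U V W W' (h : W -> W') (F : U -> V -> W) t :
  is_lin h -> h (tlift F t) = tlift (fun u v => h (F u v)) t.
Proof. exact: linear_is_sum. Qed.

Lemma eq_tlift U V W (F G : U -> V -> W) t :
  F =2 G -> tlift F t = tlift G t.
Proof. by move=> FG; apply: eq_bigr => z _. Qed.

(** [tlift] sums over the fixed list [repr t], so linearity in an outside parameter passes through
    termwise; nested Sweedler sums are handled this way. *)
Lemma linear_tlift_param (X U V W : lmodType K) (F : X -> U -> V -> W) t :
  (forall u v, is_lin (fun x => F x u v)) -> is_lin (fun x => tlift (F x) t).
Proof.
move=> lF a x y; rewrite /tlift scaler_sumr -big_split /=.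
by apply: eq_bigr => z _; rewrite lF.
Qed.

Lemma bilPl U V W (F : {bilinear U -> V -> W}) a x y v :
  F (a *: x + y) v = a *: F x v + F y v.
Proof. exact: linearPl. Qed.

Lemma bilPr U V W (F : {bilinear U -> V -> W}) u a x y :
  F u (a *: x + y) = a *: F u x + F u y.
Proof. exact: linearPr. Qed.

Lemma bilin_bilinear U V W (F : {bilinear U -> V -> W}) : bilin F.
Proof. by split=> [v|u] a x y; rewrite ?bilPl ?bilPr. Qed.

Lemma bilin_comp U V U' V' W (F : U' -> V' -> W) (f : U -> U') (g : V -> V') :
  bilin F -> is_lin f -> is_lin g -> bilin (fun u v => F (f u) (g v)).
Proof.
by move=> [Fl Fr] lf lg; split=> [v|u] a x y /=; rewrite ?lf ?lg; [exact: Fl|exact: Fr].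
Qed.

Lemma tmap_linear U V U' V' (f : U -> U') (g : V -> V') :
  is_lin f -> is_lin g -> is_lin (tmap f g).
Proof.
move=> lf lg; apply: tlift_is_linear; apply: bilin_comp => //.
exact: bilin_bilinear.
Qed.

Definition trilin (U V W X : lmodType K) (F : U -> V -> W -> X) :=
  [/\ forall v w, is_lin (fun u => F u v w), forall u w, is_lin (fun v => F u v w)
    & forall u v, is_lin (F u v)].

End Sweedler.

(** * Sums over compositions of an integer *)

(** A composition of [k] is determined by all its parts but the last, whose positivity says that the
    others sum to less than [k]. Since [k <= N], the recovered last part fits in ['I_N.+1]. *)
Lemma sum_compositions_rcons (M : nmodType) N m k (F : seq nat -> M) :
  (k <= N)%N ->
  \sum_(t : m.+1.-tuple 'I_N.+1 |
      all (fun i : 'I_N.+1 => 0 < i)%N t && (\sum_(i <- t) i == k)%N)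
    F [seq nat_of_ord i | i <- t] =
  \sum_(t : m.-tuple 'I_N.+1 |
      all (fun i : 'I_N.+1 => 0 < i)%N t && (\sum_(i <- t) i < k)%N)
    F (rcons [seq nat_of_ord i | i <- t] (k - \sum_(i <- t) i)%N).
Proof.
move=> kN; pose h (x : m.-tuple 'I_N.+1 * 'I_N.+1) := [tuple of rcons x.1 x.2].
have h_bij : bijective h.
  apply: inj_card_bij; last by rewrite card_prod !card_tuple expnSr.
  by move=> [a c] [a' c'] /(congr1 val) /= /rcons_inj[/val_inj -> ->].
rewrite (reindex h) /=; last exact: onW_bij.
under eq_bigl => x do rewrite all_rcons -cats1 big_cat big_seq1 /= andbAC andbC.
under eq_bigr => x _ do rewrite map_rcons.
rewrite -(pair_big_dep (fun a : m.-tuple _ => all (fun i : 'I_N.+1 => 0 < i)%N a)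
  (fun a (c : 'I_N.+1) => (0 < c) && (\sum_(i <- a) i + c == k))%N
  (fun a (c : 'I_N.+1) => F (rcons [seq nat_of_ord i | i <- a] c))) /=.
rewrite big_mkcondr; apply: eq_bigr => a _; set s := (\sum_(i <- a) i)%N.
have [sk|ks] := ltnP; last first.
  rewrite big_pred0 // => c; apply/negP => /andP[c0 /eqP E].
  by move: ks; rewrite -E leqNgt -[X in (X < _)%N]addn0 ltn_add2l c0.
have cN : (k - s < N.+1)%N by rewrite ltnS (leq_trans (leq_subr _ _)).
rewrite (big_pred1 (Ordinal cN)) // => c; rewrite /= -val_eqE /=.
apply/andP/eqP => [[_ /eqP <-]|->]; first by rewrite addKn.
by rewrite subn_gt0 sk subnKC // ltnW.
Qed.

Lemma leq_size_sum N (s : seq 'I_N) :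
  all (fun i : 'I_N => 0 < i)%N s -> (size s <= \sum_(i <- s) i)%N.
Proof.
elim: s => //= x s IH /andP[x0 /IH hs].
by rewrite big_cons -add1n leq_add.
Qed.

(** * Reduced coproduct and convolution products *)

Section Bialgebra.
Variables (K : fieldType) (B : lmodType K).
Variables (prec bul : {bilinear B -> B -> B}).
Variable Delta : {linear aug B -> tensor (aug B) (aug B)}.
Notation rD := (rDelta Delta).
Notation star := (star prec bul).
Notation eprec := (eprec prec Delta).
Notation estar := (estar prec bul Delta).

Lemma inB_linear : is_lin (@inB K B).
Proof.
move=> a x y; rewrite /inB; apply/eqP; rewrite xpair_eqE /=.
by rewrite scaler0 addr0 !eqxx.
Qed.

Lemma prB_linear : is_lin (@prB K B).
Proof. by []. Qed.

Lemma prB_unit : prB (unitA B) = 0. Proof. by []. Qed.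

Lemma inB_prB (a : aug B) : epsA a = 0 -> inB (prB a) = a.
Proof. by case: a => x y /= ->. Qed.

Lemma star_bilin : bilin star.
Proof.
by split=> [v|u] a x y; rewrite /Defs.star !bilPl !bilPr !scalerDr;
  rewrite [X in X + _ = _]addrACA [LHS]addrACA.
Qed.

Lemma starPl a x y z : star (a *: x + y) z = a *: star x z + star y z.
Proof. exact: (star_bilin.1 z). Qed.

Lemma pr_unitl x : tmap (@prB K B) (@prB K B) (unitA B *t x) = 0.
Proof.
rewrite /tmap tlift_is_tens ?prB_unit; last exact: bilin_comp (bilin_bilinear _) prB_linear prB_linear.
by rewrite linear0l.
Qed.

Lemma pr_unitr x : tmap (@prB K B) (@prB K B) (x *t unitA B) = 0.
Proof.
rewrite /tmap tlift_is_tens ?prB_unit; last exact: bilin_comp (bilin_bilinear _) prB_linear prB_linear.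
by rewrite linear0r.
Qed.

(** Both terms subtracted in [Delta_rem] have a factor [unitA], which [prB] kills. *)
Lemma rDeltaE b : rD b = tmap (@prB K B) (@prB K B) (Delta (inB b)).
Proof.
have l := tmap_linear prB_linear prB_linear.
by rewrite /rDelta /Delta_rem !(linear_isB l) pr_unitl pr_unitr !subr0.
Qed.

Lemma rDelta_linear : is_lin rD.
Proof.
move=> a x y; rewrite !rDeltaE inB_linear linearP /=.
exact: tmap_linear prB_linear prB_linear _ _ _.
Qed.

Hypothesis hA : quasi_shuffle_bialgebra prec bul Delta.

(* Hence coassociativity of rDelta is the image of that of Delta under
   prB (x) prB (x) prB. *)
Lemma tmap_prB_Delta a :
  tmap (@prB K B) (@prB K B) (Delta a) = rD (prB a).
Proof.
have -> : a = a.1 *: unitA B + inB (prB a).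
  case: a => x y; apply/eqP; rewrite xpair_eqE /=.
  by rewrite scaler0 add0r addr0 [x *: _]mulr1 !eqxx.
rewrite linearP /= (tmap_linear prB_linear prB_linear) (qsb_unit hA).
by rewrite pr_unitl scaler0 add0r -rDeltaE /= scaler0 add0r.
Qed.

(** Stated against a trilinear test function, so that it applies directly to Sweedler
    expressions. *)
Lemma rDelta_coassoc (W : lmodType K) (F : B -> B -> B -> W) b : trilin F ->
  tlift (fun s w => tlift (fun u v => F u v w) (rD s)) (rD b) =
  tlift (fun u s => tlift (fun v w => F u v w) (rD s)) (rD b).
Proof.
move=> [F1 F2 F3].
(* Pairing the coassociativity of [Delta] with [G] evaluates [F] on the [prB]-projections of the
   three tensor factors. *)
pose G (u : aug B) s := tlift (fun v w => F (prB u) (prB v) (prB w)) s.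
have bG : bilin G.
  split=> [s|u]; first by apply: linear_tlift_param => v w a x y; rewrite /= F1.
  by apply: tlift_is_linear; split=> [w|v] a x y; rewrite /= ?F2 ?F3.
have := congr1 (tlift G) (qsb_coassoc hA (inB b)).
rewrite tlift_tmap // /tassoc tlift_tmap; last first.
  split=> [w|s].
    apply: tlift_is_linear; split=> [v|u] a x y; first by rewrite bilPl.
    by rewrite bilPl bilPr.
  by apply: linear_tlift_param => u v a x y; rewrite !bilPr.
rewrite linear_tlift; last exact: tlift_is_linear.
set L := LHS; set R := RHS => LR.
have -> : tlift (fun s w => tlift (fun u v => F u v w) (rD s)) (rD b) = L.
  rewrite [in RHS]/L rDeltaE tlift_tmap; last first.
    split=> [w|s].
      move=> a x y; rewrite rDelta_linear; apply: tlift_is_linear.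
      by split=> [v|u] c z t; rewrite ?F1 ?F2.
    by apply: linear_tlift_param => u v a x y; rewrite F3.
  apply: eq_tlift => s w; rewrite -tmap_prB_Delta tlift_tmap; last first.
    by split=> [v|u] c z t; rewrite ?F1 ?F2.
  rewrite linear_tlift; last exact: tlift_is_linear.
  apply: eq_tlift => u v; rewrite tlift_is_tens // /G tlift_is_tens //.
  by split=> [z|z] a x y; rewrite /= ?F2 ?F3.
rewrite LR /R rDeltaE tlift_tmap; last first.
  split=> [s|u]; first by apply: linear_tlift_param => u v a x y; rewrite F1.
  move=> a x y; rewrite rDelta_linear; apply: tlift_is_linear.
  by split=> [v|w] c z t; rewrite ?F2 ?F3.
apply: eq_tlift => u s; rewrite -tmap_prB_Delta tlift_tmap //.
Qed.

Lemma convE (op : B -> B -> B) f g b : bilin op ->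
  conv Delta op f g b = tlift (fun u v => op (f u) (g v)) (rD b).
Proof. exact: tlift_tmap. Qed.

Lemma eprecE f g b : eprec f g b = tlift (fun u v => prec (f u) (g v)) (rD b).
Proof. exact/convE/bilin_bilinear. Qed.

Lemma estarE f g b : estar f g b = tlift (fun u v => star (f u) (g v)) (rD b).
Proof.
rewrite /Defs.estar /esucc /Defs.eprec /ebul !fctE !convE //; try exact: bilin_bilinear.
  by rewrite /tlift -!big_split.
by split=> [v|u] a x y; rewrite /succ ?bilPl ?bilPr.
Qed.

Lemma eprec_linear f g : is_lin f -> is_lin g -> is_lin (eprec f g).
Proof.
move=> lf lg a x y; rewrite !eprecE rDelta_linear.
apply: tlift_is_linear; apply: bilin_comp => //; exact: bilin_bilinear.
Qed.

Lemma estar_linear f g : is_lin f -> is_lin g -> is_lin (estar f g).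
Proof.
move=> lf lg a x y; rewrite !estarE rDelta_linear.
apply: tlift_is_linear; apply: bilin_comp => //; exact: star_bilin.
Qed.

Lemma eprecPl a f g h :
  eprec (a *: f + g) h = a *: eprec f h + eprec g h.
Proof.
apply/funext => b; rewrite !fctE !eprecE.
rewrite /tlift scaler_sumr -big_split; apply: eq_bigr => z _.
by rewrite /= bilPl.
Qed.

(** Coassociativity regroups the three Sweedler factors; [qs_precA] then applies termwise. *)
Lemma eprecA f g h : is_lin f -> is_lin g -> is_lin h ->
  eprec (eprec f g) h = eprec f (estar g h).
Proof.
move=> lf lg lh; apply/funext => b; rewrite !eprecE.
transitivity (tlift (fun s w => tlift
  (fun u v => prec (prec (f u) (g v)) (h w)) (rD s)) (rD b)).
  apply: eq_tlift => s w; rewrite eprecE.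
  by apply: (linear_tlift (h := prec^~ (h w))) => a x y; rewrite /= bilPl.
rewrite rDelta_coassoc; last first.
  split=> u v a x y; first by rewrite lf !bilPl.
    by rewrite lg bilPr bilPl.
  by rewrite lh bilPr.
apply: eq_tlift => u s; rewrite estarE [RHS](linear_tlift (h := prec (f u))).
  by apply: eq_tlift => v w; rewrite (qs_precA (qsb_algebra hA)).
by move=> a x y; rewrite bilPr.
Qed.

(** * Homogeneous elements and induction on the degree *)

Section Graded.
Variable gr : nat -> set (aug B).
Hypothesis hgr : graded_connected_qsb prec bul Delta gr.

Definition homog n (b : B) := (0 < n)%N /\ gr n (inB b).

(** Comes from a decomposition in [aug B]: by connectedness [prB] kills its degree 0 term, hence the
    shift from [n] to [n.+1]. *)
Lemma homog_sum b : exists (N : nat) (c : nat -> B),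
  (forall n, homog n.+1 (c n)) /\ b = \sum_(n < N) c n.
Proof.
have [N [c [hc bE]]] := gr_span (gqs_grading hgr) (inB b).
have pc0 : prB (c 0%N) = 0 by have := hc 0%N; rewrite (gqs_connected hgr).
exists N.-1, (fun n => prB (c n.+1)); split=> [n|].
  by split=> //; rewrite inB_prB //; apply: (gqs_augmentation hgr) (hc n.+1).
rewrite -[b]/(prB (inB b)) bE linear_is_sum; last exact: prB_linear.
by case: N {bE} => [|N]; rewrite ?big_ord0 // big_ord_recl pc0 add0r.
Qed.

Lemma rDelta_homog n b : homog n b -> exists s : seq (B * B),
  rD b = \sum_(z <- s) z.1 *t z.2 /\
  forall z, z \in s -> exists2 i, (i < n)%N & homog i z.1.
Proof.
move=> [n0 hb]; have [s [DE hs]] := gqs_Delta hgr hb.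
pose pr (z : aug B * aug B) := (prB z.1, prB z.2).
(* Pure tensors with a zero factor are dropped. By connectedness the surviving factors have positive
   degree, so [i + j = n] forces [i < n]. *)
exists [seq z <- [seq pr z | z <- s] | (z.1 != 0) && (z.2 != 0)]; split.
  rewrite rDeltaE DE /tmap tlift_sum_tens; last first.
    exact: bilin_comp (bilin_bilinear _) prB_linear prB_linear.
  rewrite big_filter big_map [RHS]big_mkcond /=; apply: eq_bigr => z _.
  by case: eqVneq => [->|_]; rewrite ?linear0l //; case: eqVneq => [->|//]; rewrite linear0r.
move=> z; rewrite mem_filter => /andP[/andP[z1 z2] /mapP[w ws zE]].
have [i [j [ij gi gj]]] := hs _ ws.
have i0 : (0 < i)%N.
  rewrite lt0n; apply: contraNneq z1 => i0; apply/eqP.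
  by move: gi; rewrite i0 (gqs_connected hgr) zE.
have j0 : (0 < j)%N.
  rewrite lt0n; apply: contraNneq z2 => j0; apply/eqP.
  by move: gj; rewrite j0 (gqs_connected hgr) zE.
exists i; first by rewrite -ij -addn1 leq_add2l.
by split=> //; rewrite zE /= inB_prB //; apply: (gqs_augmentation hgr) gi.
Qed.

Lemma homog_ext (W : lmodType K) (f g : B -> W) : is_lin f -> is_lin g ->
  (forall n b, homog n b -> f b = g b) -> f =1 g.
Proof.
move=> lf lg fg b; have [N [c [hc ->]]] := homog_sum b.
rewrite !linear_is_sum //; apply: eq_bigr => n _; exact: fg (hc n).
Qed.

(** In degree [n], the left factors of the reduced coproduct have degree below [n]; this is the
    engine of every recursion on the equation of [pi]. *)
Lemma eprec_ext_lt f g h n b : is_lin f -> is_lin g -> is_lin h -> homog n b ->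
  (forall i x, (i < n)%N -> homog i x -> f x = g x) ->
  eprec f h b = eprec g h b.
Proof.
move=> lf lg lh hb fg; rewrite !eprecE; have [s [-> hs]] := rDelta_homog hb.
have bprec := bilin_bilinear prec.
rewrite !tlift_sum_tens; do ?exact: bilin_comp.
apply: eq_big_seq => z /hs[i ltin hz]; by rewrite (fg _ _ ltin hz).
Qed.

(** * Existence and uniqueness of [pi] *)

Lemma id_is_lin : is_lin (@id B). Proof. by []. Qed.

Lemma sub_is_lin (f g : B -> B) : is_lin f -> is_lin g -> is_lin (fun b => f b - g b).
Proof.
by move=> lf lg a x y /=; rewrite lf lg scalerBr opprD addrACA.
Qed.

(** Iteration, from 0, of the fixed-point form [pi = Id - pi < Id]; stage [k] is final in degrees up
    to [k]. *)
Fixpoint pi_approx k : B -> B :=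
  if k is k'.+1 then fun b => b - eprec (pi_approx k') id b else fun _ => 0.

Lemma pi_approx_lin k : is_lin (pi_approx k).
Proof.
elim: k => [|k IH]; first by move=> a x y; rewrite scaler0 addr0.
by apply: (sub_is_lin id_is_lin); apply: eprec_linear.
Qed.

Lemma pi_approx_stable n k b : homog n b -> (n <= k)%N ->
  pi_approx k b = pi_approx n b.
Proof.
elim/ltn_ind: n k b => -[//|n] IH [//|k] b hb; first by case: hb.
rewrite ltnS => nk /=; congr (_ - _).
apply: (eprec_ext_lt _ _ _ hb); try exact: pi_approx_lin.
  exact: id_is_lin.
move=> i x; rewrite ltnS => lin hx.
(* On [x] of degree [i], both stages [k] and [n] agree with stage [i]. *)
by rewrite (IH i lin k x hx (leq_trans lin nk)) (IH i lin n x hx lin).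
Qed.

Lemma pi_approx_limit b :
  exists N, forall k, (N <= k)%N -> pi_approx k b = pi_approx N b.
Proof.
have [N [c [hc ->]]] := homog_sum b; exists N => k Nk.
rewrite !(linear_is_sum _ _ _ (pi_approx_lin _)); apply: eq_bigr => i _.
have iN := ltn_ord i.
by rewrite (pi_approx_stable (hc i)) ?(pi_approx_stable (hc i) iN) // (leq_trans iN).
Qed.

Lemma pi_exists : exists pi, is_pi prec Delta pi.
Proof.
(* No single stage need serve for all [b]: [pi b] is the eventual value of the stages at [b]. *)
have [N hN] := boolp.choice pi_approx_limit.
pose pi b := pi_approx (N b) b.
have piE k b : (N b <= k)%N -> pi_approx k b = pi b by exact: hN.
exists pi; split.
  suff: is_lin pi by [].
  (* A stage late enough for all three vectors, so that linearity is inherited from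
     [pi_approx k]. *)
  move=> a x y; pose k := (N (a *: x + y)%R + N x + N y)%N.
  rewrite -!(piE k) ?pi_approx_lin // /k.
  - by rewrite leq_addl.
  - by rewrite -addnA addnCA leq_addr.
  - by rewrite -addnA leq_addr.
apply/funext => b; rewrite fctE.
(* Stage [k] is final at every left factor of the chosen representative of [rD b], and stage [k.+1]
   at [b]; the recursion step between them is the equation of [pi]. *)
pose k := (N b + \sum_(z <- repr (rD b)) N z.1)%N.
rewrite -(piE k.+1 b); last by rewrite leqW // leq_addr.
rewrite /= !eprecE (_ : tlift _ _ = tlift (fun u v => prec (pi u) v) (rD b)).
  by rewrite subrK.
apply: eq_big_seq => z zs; rewrite piE // /k (big_rem _ zs) /=.
by rewrite addnCA leq_addr.
Qed.

Variable pi : B -> B.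
Hypothesis hpi : is_pi prec Delta pi.

Lemma pi_lin : is_lin pi. Proof. by have [] := hpi. Qed.

Lemma piE b : pi b = b - eprec pi id b.
Proof.
have [_ /(congr1 (fun h => h b))] := hpi.
by rewrite fctE => {2}->; rewrite addrK.
Qed.

Lemma pi_unique pi' : is_pi prec Delta pi' -> pi = pi'.
Proof.
move=> hpi'; have lpi' : is_lin pi' by have [] := hpi'.
apply/funext/(homog_ext pi_lin lpi') => n b.
elim/ltn_ind: n b => n IH b hb; rewrite piE.
have [_ /(congr1 (fun h => h b))] := hpi'.
rewrite fctE => E; rewrite {1}[b]E (eprec_ext_lt pi_lin lpi' id_is_lin hb) ?addrK //.
by move=> i x lin hx; apply: IH lin _ hx.
Qed.

(** * Projection onto the primitive elements *)

Lemma pi_prim b : rD (pi b) = 0.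
Proof.
have l0 : is_lin (fun _ : B => 0 : tensor B B).
  by move=> a x y; rewrite scaler0 addr0.
have lr : is_lin (rD \o pi) by move=> a x y; rewrite /= pi_lin rDelta_linear.
apply: (homog_ext lr l0) => n {}b; elim/ltn_ind: n b => n IH b hb /=.
(* For primitive [x], the terms of [qsb_prec] that sum over [rDelta x] vanish. *)
have prec_prim x y : rD x = 0 ->
    rD (prec x y) = tlift (fun y' y'' => prec x y' *t y'') (rD y) + x *t y.
  move=> x0; rewrite (qsb_prec hA) x0 !(linear_is0 (tlift_is_linear _)) ?add0r ?addr0 //.
  - by split=> [v|u] a x1 x2; rewrite ?bilPl ?bilPr ?bilPl.
  - by split=> [v|u] a x1 x2; rewrite ?starPl ?bilPl ?bilPr.
  - by split=> [v|u]; apply: linear_tlift_param => y1 y2 a x1 x2;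
      rewrite ?starPl ?bilPl ?bilPr.
have bt := bilin_bilinear (@tens K B B).
have E : rD (eprec pi id b) =
    tlift (fun u v => tlift (fun y' y'' => prec (pi u) y' *t y'') (rD v)) (rD b)
    + tlift (fun u v => pi u *t v) (rD b).
  (* A homogeneous expansion is required here: it puts each left factor in degree below [n], where
     the induction hypothesis makes [pi z.1] primitive. *)
  rewrite eprecE; have [s [-> hs]] := rDelta_homog hb.
  have bprec := bilin_bilinear prec.
  rewrite tlift_sum_tens; last exact: bilin_comp pi_lin id_is_lin.
  rewrite (linear_is_sum _ _ _ rDelta_linear) !tlift_sum_tens.
  - rewrite -big_split; apply: eq_big_seq => z /hs[i lin hz].
    exact/prec_prim/(IH _ lin).
  - exact: bilin_comp pi_lin id_is_lin.
  - split=> [v|u].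
      by apply: linear_tlift_param => y1 y2 a x1 x2; rewrite pi_lin ?bilPl.
    move=> a x1 x2; rewrite rDelta_linear; apply: tlift_is_linear.
    by split=> [v|w] c x3 x4; rewrite ?bilPr ?bilPl.
rewrite piE (linear_isB rDelta_linear) E.
(* Moving the inner coproduct to the left factor leaves the right factor of [rD b] untouched, so the
   cancellation can be checked on each pure tensor. *)
rewrite -(rDelta_coassoc (F := fun u v w => prec (pi u) v *t w)); last first.
  by split=> u v a x y; rewrite ?pi_lin ?bilPl ?bilPr ?bilPl.
rewrite /tlift -big_split /= {1}[rD b]tensor_sum -sumrB big1 // => z _.
(* The equation of [pi] at [z.1], tensored with [z.2]. *)
have zE : z.1 *t z.2 =
    pi z.1 *t z.2 + tlift (fun u v => prec (pi u) v *t z.2) (rD z.1).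
  rewrite -(linear_tlift (h := fun x => x *t z.2)); last first.
    by move=> a x y; rewrite bilPl.
  by rewrite -linearDl -eprecE piE subrK.
by rewrite zE addrC subrr.
Qed.

(** On a primitive element the correction [pi < Id] is a sum over a zero tensor, so [pi] fixes it;
    [pi_prim] gives the rest. *)
Lemma pi_projection : is_projection_onto pi (Prim Delta).
Proof.
have pi_id b : rD b = 0 -> pi b = b.
  move=> b0; rewrite piE eprecE b0 linear_is0 ?subr0 //.
  apply: tlift_is_linear; exact: bilin_comp (bilin_bilinear _) pi_lin id_is_lin.
split=> [x|]; first by rewrite pi_id // pi_prim.
by apply/seteqP; split=> [_ [x _ <-]|x x0] /=; [exact: pi_prim | exists x; rewrite ?pi_id].
Qed.

(** * Homogeneous components of [Id] and [pi] *)

Variable p : nat -> B -> B.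
Hypothesis hp : forall n, (0 < n)%N -> is_proj_component gr n (p n).

Lemma p_lin n : (0 < n)%N -> is_lin (p n).
Proof. by case/hp. Qed.

Lemma p_homog n m x : (0 < n)%N -> homog m x -> p n x = if m == n then x else 0.
Proof. by move=> /hp[_ h] [m0 hx]; apply: h. Qed.

(** By linearity, [x] and [y] may be taken of degrees [i] and [j]. Only the summand [a = i] can
    survive, and it does so only when [i + j = n]. *)
Lemma p_prec n x y : (0 < n)%N ->
  p n (prec x y) = \sum_(1 <= a < n) prec (p a x) (p (n - a)%N y).
Proof.
move=> n0.
have sum_lin (F : nat -> B -> B) : (forall a, (0 < a < n)%N -> is_lin (F a)) ->
    is_lin (fun x => \sum_(1 <= a < n) F a x).
  move=> lF c u v; rewrite scaler_sumr -big_split; apply: eq_big_nat => a an.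
  by rewrite lF.
apply: (homog_ext (f := fun x => p n (prec x y))
                  (g := fun x => \sum_(1 <= a < n) prec (p a x) (p (n - a)%N y))).
- by move=> c u v; rewrite bilPl p_lin.
- by apply: sum_lin => a /andP[a0 _] c u v; rewrite p_lin ?bilPl.
move=> i {}x hx.
apply: (homog_ext (f := fun y => p n (prec x y))
                  (g := fun y => \sum_(1 <= a < n) prec (p a x) (p (n - a)%N y))).
- by move=> c u v; rewrite bilPr p_lin.
- by apply: sum_lin => a /andP[_ an] c u v; rewrite p_lin ?bilPr // subn_gt0.
move=> j {}y hy; have [i0 gi] := hx; have [j0 gj] := hy.
have hxy : homog (i + j) (prec x y).
  by split; [rewrite addn_gt0 i0|exact: (gqs_prec hgr)].
rewrite (p_homog n0 hxy).
have termE a : (1 <= a < n)%N ->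
    prec (p a x) (p (n - a)%N y) = if a == i then if (i + j)%N == n then prec x y else 0 else 0.
  move=> /andP[a0 an]; rewrite (p_homog a0 hx) (p_homog _ hy) ?subn_gt0 //.
  rewrite eq_sym; case: eqVneq => [ai|_]; last by rewrite linear0l.
  rewrite -(eqn_add2l i) ai subnKC -?ai 1?ltnW //.
  by case: ifP => // _; rewrite linear0r.
rewrite (eq_big_nat _ _ termE) -big_mkcond /=.
case: eqVneq => [ijn|_]; last by rewrite big1.
(* The bound [i < n] comes from [0 < j]. *)
have hi : i \in index_iota 1 n by rewrite mem_index_iota i0 -ijn -addn1 leq_add2l.
rewrite big_mkcond (bigD1_seq i hi (iota_uniq _ _)) /= eqxx big1 ?addr0 //.
by move=> a /negPf ->.
Qed.

Lemma q_rec n : (0 < n)%N ->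
  p n \o pi = p n - \sum_(1 <= a < n) eprec (p a \o pi) (p (n - a)%N).
Proof.
move=> n0; apply/funext => b.
rewrite -[RHS]/(p n b - (\sum_(1 <= a < n) eprec (p a \o pi) (p (n - a)%N)) b).
rewrite fct_sumE /= {1}piE (linear_isB (p_lin n0)); congr (_ - _).
rewrite eprecE (linear_tlift _ _ (p_lin n0)).
under eq_tlift do rewrite p_prec //.
by rewrite /tlift exchange_big; apply: eq_bigr => a _; rewrite eprecE.
Qed.

(** * Explicit formula through compositions *)

Lemma eprec_suml I (r : seq I) (P : pred I) (F : I -> B -> B) h :
  eprec (\sum_(i <- r | P i) F i) h = \sum_(i <- r | P i) eprec (F i) h.
Proof.
by apply: (linear_is_sum _ _ _ (f := eprec^~ h)) => a f g; rewrite eprecPl.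
Qed.

(** By [eprecA], multiplying by [h] on the right appends [h] to the inner star product, which
    [foldl] nests to the left. *)
Lemma prec_star_rcons (s : seq (B -> B)) h :
  (0 < size s)%N -> {in s, forall f, is_lin f} -> is_lin h ->
  prec_star prec bul Delta (rcons s h) = eprec (prec_star prec bul Delta s) h.
Proof.
case: s => [//|f [//|g s]] _ ls lh; rewrite /= foldl_rcons eprecA //.
- exact/ls/mem_head.
- have lg : is_lin g by apply: ls; rewrite !inE eqxx orbT.
  have {}ls : {in s, forall f, is_lin f} by move=> u us; apply: ls; rewrite !inE us !orbT.
  (* The inner star product is linear, as [eprecA] asks. *)
  elim: s g lg ls => //= u s IH g lg ls; apply: IH => [|v vs].
    by apply: estar_linear => //; apply/ls/mem_head.
  by apply: ls; rewrite inE vs orbT.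
Qed.

(** The bound [N] is kept apart from [k], so that all the degrees met in the recursion share one
    index type. *)
Definition comp_sum N m k : B -> B :=
  \sum_(a : m.-tuple 'I_N.+1 |
      all (fun i : 'I_N.+1 => 0 < i)%N a && (\sum_(i <- a) i == k)%N)
    prec_star prec bul Delta [seq p (i : 'I_N.+1) | i <- a].

Lemma comp_sumE N m k : comp_sum N m k =
  \sum_(a : m.-tuple 'I_N.+1 |
      all (fun i : 'I_N.+1 => 0 < i)%N a && (\sum_(i <- a) i == k)%N)
    prec_star prec bul Delta (map p [seq nat_of_ord i | i <- a]).
Proof. by apply: eq_bigr => a _; rewrite -map_comp. Qed.

Lemma comp_sum1 N k : (0 < k <= N)%N -> comp_sum N 1 k = p k.
Proof.
move=> /andP[k0 kN].
rewrite comp_sumE (sum_compositions_rcons _ (fun s => prec_star _ _ _ (map p s))) //.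
rewrite (big_pred1 [tuple]) => [|t] /=; first by rewrite big_nil subn0.
by rewrite (tuple0 t) /= big_nil k0.
Qed.

(** Detach the last part [k - j] and group the compositions by the sum [j] of the other parts. *)
Lemma comp_sum_rec N m k : (k <= N)%N ->
  comp_sum N m.+2 k = \sum_(1 <= j < k) eprec (comp_sum N m.+1 j) (p (k - j)%N).
Proof.
move=> kN.
rewrite comp_sumE (sum_compositions_rcons _ (fun s => prec_star _ _ _ (map p s))) //.
under [RHS]eq_bigr => j _ do rewrite comp_sumE eprec_suml big_mkcondr.
rewrite exchange_big big_mkcondr /=; apply: eq_bigr => a a_pos.
rewrite -big_mkcond /=; set s := (\sum_(i <- a) i)%N.
(* There are [m.+1] remaining parts, at least one, so [s] lies in the range starting at 1. *)
have s0 : (0 < s)%N by apply: leq_trans (leq_size_sum a_pos); rewrite size_tuple.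
have [sk|ks] := ltnP; last first.
  rewrite big_nat_cond big_pred0 // => j; apply/negP => /andP[/andP[_ jk] /eqP sj].
  by move: jk; rewrite -sj ltnNge ks.
have hs : s \in index_iota 1 k by rewrite mem_index_iota s0.
rewrite big_mkcond (bigD1_seq s hs (iota_uniq _ _)) /= eqxx big1 ?addr0; last first.
  by move=> j /negPf sj; rewrite eq_sym sj.
rewrite map_rcons prec_star_rcons ?size_map ?size_tuple //; last first.
  by apply: p_lin; rewrite subn_gt0.
move=> f /mapP[_ /mapP[i ia ->] ->]; exact/p_lin/(allP a_pos).
Qed.

Lemma comp_sum_small N m k : (k < m)%N -> comp_sum N m k = 0.
Proof.
move=> km; rewrite /comp_sum big_pred0 // => a; apply/negP => /andP[/leq_size_sum].
by rewrite size_tuple => h /eqP E; move: h; rewrite E leqNgt km.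
Qed.

(** The sum runs to [N] for every [n], which lets [q_rec] exchange it with the sum over degrees;
    terms with [m > n] vanish. Each use of [q_rec] adds one part and one sign. *)
Lemma q_comp_sum N n : (0 < n <= N)%N ->
  p n \o pi = \sum_(1 <= m < N.+1) (-1) ^+ m.+1 *: comp_sum N m n.
Proof.
elim/ltn_ind: n => n IH /andP[n0 nN]; rewrite q_rec //.
have E : \sum_(1 <= a < n) eprec (p a \o pi) (p (n - a)%N) =
    \sum_(1 <= m < N.+1) (-1) ^+ m.+1 *: comp_sum N m.+1 n.
  under eq_big_nat => a /andP[a0 an].
    rewrite (IH a) // ?a0 ?(leq_trans (ltnW an)) // eprec_suml.
    under eq_bigr => m _.
      (* A zero summand is added to match the form of [eprecPl]. *)
      rewrite -[_ *: _]addr0 eprecPl.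
      rewrite (_ : eprec 0 _ = 0) ?addr0; last first.
        apply/funext => b; rewrite eprecE /tlift big1 // => z _.
        by rewrite linear0l.
      over.
    over.
  rewrite exchange_big /=; apply: eq_big_nat => m /andP[m0 _].
  by rewrite -scaler_sumr -(prednK m0) comp_sum_rec.
rewrite E [RHS]big_ltn; last by rewrite ltnS (leq_trans n0).
rewrite comp_sum1 ?n0 // sqrrN expr1n scale1r.
congr (_ + _).
(* The top term has [N.+1] parts for a sum [n <= N], hence is 0; the others match after shifting [m]
   by one. *)
rewrite big_nat_recr /=; last by rewrite (leq_trans n0).
rewrite comp_sum_small ?ltnS // scaler0 addr0 [RHS]big_add1 /= -sumrN.
by apply: eq_bigr => m _; rewrite -scaleNr -mulN1r -exprS.
Qed.

(** * Equality of the generated subalgebras *)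

Lemma subspace_sum (V : lmodType K) (S : set V) I (r : seq I) (P : pred I) (F : I -> V) :
  is_subspace S -> (forall i, P i -> S (F i)) -> S (\sum_(i <- r | P i) F i).
Proof.
move=> [S0 SP] hF; elim/big_ind: _ => // x y Sx Sy.
by rewrite -[x]scale1r; apply: SP.
Qed.

Lemma nqsh_generated_pq :
  nqsh_generated prec bul Delta [set p n | n in [set n | (0 < n)%N]] =
  nqsh_generated prec bul Delta [set p n \o pi | n in [set n | (0 < n)%N]].
Proof.
(* It suffices that the same NQSh subalgebras contain each family, as the generated ones are their
   intersections. *)
suff pq (S : set (B -> B)) : nqsh_subalgebra prec bul Delta S ->
    [set p n | n in [set n | (0 < n)%N]] `<=` S <->
    [set p n \o pi | n in [set n | (0 < n)%N]] `<=` S.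
  by apply/seteqP; split=> f Sf S [hS hG]; apply: Sf; split=> //; apply/pq.
move=> hS; have sS := nqsh_subspace hS.
have sum_q n : (forall a, (0 < a < n)%N -> S (p a \o pi)) ->
    (forall a, (0 < a < n)%N -> S (p a)) ->
    S (\sum_(1 <= a < n) eprec (p a \o pi) (p (n - a)%N)).
  move=> Sq Sp; rewrite big_nat; apply: subspace_sum => // a /andP[a0 an].
  apply: (nqsh_prec hS); first by apply: Sq; rewrite a0.
  by apply: Sp; rewrite subn_gt0 an ltn_subrL a0 (ltn_trans a0).
split=> hG _ [n /= n0 <-].
  have Sp a : (0 < a)%N -> S (p a) by move=> a0; apply: hG; exists a.
  elim/ltn_ind: n n0 => n IH n0; rewrite q_rec // addrC -scaleN1r.
  apply: sS.2; last exact: Sp.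
  by apply: sum_q => a /andP[a0 an]; [exact: IH | exact: Sp].
have Sq a : (0 < a)%N -> S (p a \o pi) by move=> a0; apply: hG; exists a.
elim/ltn_ind: n n0 => n IH n0.
(* The relation [q_rec] solved for [p n], whose other terms involve only [p] of lower index. *)
have -> : p n = 1 *: (\sum_(1 <= a < n) eprec (p a \o pi) (p (n - a)%N)) + (p n \o pi).
  by rewrite q_rec // scale1r addrC subrK.
apply: sS.2; last exact: Sq.
by apply: sum_q => a /andP[a0 an]; [exact: Sq | exact: IH].
Qed.

End Graded.
End Bialgebra.
Theorem theorem43 (K : fieldType) (B : lmodType K)
  (prec bul : {bilinear B -> B -> B})
  (Delta : {linear aug B -> tensor (aug B) (aug B)})
  (gr : nat -> set (aug B))
  (hA : graded_connected_qsb prec bul Delta gr)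
  (p : nat -> B -> B)
  (hp : forall n, (0 < n)%N -> is_proj_component gr n (p n)) :
  (exists! pi : B -> B, is_pi prec Delta pi) /\
  (forall pi : B -> B, is_pi prec Delta pi ->
    let q (n : nat) : B -> B := p n \o pi in
    [/\ is_projection_onto pi (Prim Delta),
        nqsh_generated prec bul Delta [set p n | n in [set n | (0 < n)%N]] =
        nqsh_generated prec bul Delta [set q n | n in [set n | (0 < n)%N]]
      & forall n, (0 < n)%N ->
        q n = \sum_(1 <= m < n.+1) (-1) ^+ m.+1 *:
          \sum_(a : m.-tuple 'I_n.+1 |
                all (fun i : 'I_n.+1 => 0 < i)%N a && (\sum_(i <- a) i == n)%N)
            prec_star prec bul Delta [seq p (i : 'I_n.+1) | i <- a]]).
Proof.
have hqs := gqs_bialgebra hA.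
split=> [|pi hpi q].
  have [pi hpi] := pi_exists hA.
  by exists pi; split=> // pi' hpi'; apply: pi_unique hA _ hpi _ hpi'.
split.
- exact: (pi_projection hqs hA hpi).
- exact: (nqsh_generated_pq hA hpi hp).
(* The case [N = n]. *)
- by move=> n n0; apply: (q_comp_sum hqs hA hpi hp); rewrite n0 leqnn.
Qed.
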